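(* Let $G$ be a finite simple graph that is edge-maximal $K_4$-minor-free, i.e. $G$ has no $K_4$-minor but adding any edge joining two non-adjacent vertices of $G$ creates a $K_4$-minor. Then $G$ is 2-clique-colorable.
   Context: A $k$-clique-coloring of a graph $G$ is a map $\phi: V(G)\to\{1,\dots,k\}$ such that no maximal clique of $G$ with at least two vertices is monochromatic (a clique is a complete induced subgraph; it is maximal if not properly contained in another clique). $G$ is $k$-clique-colorable if it admits a $k$-clique-coloring. A graph $H$ is a minor of $G$ if $H$ can be obtained from $G$ by deleting edges, deleting vertices and contracting edges. *)

(* Defs.v *)
From HB Require Import structures.
From mathcomp Require Import all_boot.

Set Implicit Arguments.
Unset Strict Implicit.
Unset Printing Implicit Defensive.

Record sgraph := SGraph {
  vertex :> finType;
  adj : rel vertex;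
  adj_sym : symmetric adj;
  adj_irrefl : irreflexive adj
}.

Definition isomorphic (G H : sgraph) : Prop :=
  exists f : G -> H, bijective f /\ {mono f : x y / adj x y}.

Section Complete.
Variable n : nat.

Definition complete_adj : rel 'I_n := fun x y => x != y.

Lemma complete_adj_sym : symmetric complete_adj.
Proof. by move=> x y; rewrite /complete_adj eq_sym. Qed.

Lemma complete_adj_irrefl : irreflexive complete_adj.
Proof. by move=> x; rewrite /complete_adj eqxx. Qed.

Definition complete_graph : sgraph :=
  SGraph complete_adj_sym complete_adj_irrefl.
End Complete.

Section Operations.
Variables (G : sgraph) (u v : G).

Definition same_pair : rel G :=
  fun x y => ((x == u) && (y == v)) || ((x == v) && (y == u)).

Lemma same_pair_sym : symmetric same_pair.
Proof.
by move=> x y; rewrite /same_pair orbC [(x == v) && _]andbC [(x == u) && _]andbC.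
Qed.

Definition add_edge_adj : rel G :=
  fun x y => (x != y) && (adj x y || same_pair x y).

Lemma add_edge_adj_sym : symmetric add_edge_adj.
Proof. by move=> x y; rewrite /add_edge_adj eq_sym adj_sym same_pair_sym. Qed.

Lemma add_edge_adj_irrefl : irreflexive add_edge_adj.
Proof. by move=> x; rewrite /add_edge_adj eqxx. Qed.

Definition add_edge : sgraph := SGraph add_edge_adj_sym add_edge_adj_irrefl.

Definition del_edge_adj : rel G := fun x y => adj x y && ~~ same_pair x y.

Lemma del_edge_adj_sym : symmetric del_edge_adj.
Proof. by move=> x y; rewrite /del_edge_adj adj_sym same_pair_sym. Qed.

Lemma del_edge_adj_irrefl : irreflexive del_edge_adj.
Proof. by move=> x; rewrite /del_edge_adj adj_irrefl. Qed.

Definition del_edge : sgraph := SGraph del_edge_adj_sym del_edge_adj_irrefl.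

Definition del_vertex_adj : rel {x : G | x != v} :=
  fun x y => adj (val x) (val y).

Lemma del_vertex_adj_sym : symmetric del_vertex_adj.
Proof. by move=> x y; rewrite /del_vertex_adj adj_sym. Qed.

Lemma del_vertex_adj_irrefl : irreflexive del_vertex_adj.
Proof. by move=> x; rewrite /del_vertex_adj adj_irrefl. Qed.

Definition del_vertex : sgraph :=
  SGraph del_vertex_adj_sym del_vertex_adj_irrefl.

(* Contraction of the edge uv: v is removed and u stands for the merged       *)
(* vertex, which inherits the neighbours of v; the loop and the parallel      *)
(* edges that arise are dropped.                                              *)
Definition contract_adj : rel {x : G | x != v} :=
  fun x y => (x != y) &&
    [|| adj (val x) (val y),
        (val x == u) && adj v (val y) |
        (val y == u) && adj v (val x)].

Lemma contract_adj_sym : symmetric contract_adj.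
Proof.
move=> x y; rewrite /contract_adj eq_sym adj_sym.
by congr (_ && (_ || _)); rewrite orbC.
Qed.

Lemma contract_adj_irrefl : irreflexive contract_adj.
Proof. by move=> x; rewrite /contract_adj eqxx. Qed.

Definition contract_edge : sgraph := SGraph contract_adj_sym contract_adj_irrefl.

End Operations.

Inductive minor (H : sgraph) : sgraph -> Prop :=
| minor_iso (G : sgraph) : isomorphic H G -> minor H G
| minor_del_edge (G : sgraph) (u v : G) :
    adj u v -> minor H (del_edge u v) -> minor H G
| minor_del_vertex (G : sgraph) (v : G) :
    minor H (del_vertex v) -> minor H G
| minor_contract_edge (G : sgraph) (u v : G) :
    adj u v -> minor H (contract_edge u v) -> minor H G.

Definition edge_maximal_minor_free (H G : sgraph) : Prop :=
  ~ minor H G /\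
  forall u v : G, u != v -> ~~ adj u v -> minor H (add_edge u v).

Definition clique (G : sgraph) (A : {set G}) : bool :=
  [forall x in A, forall y in A, (x != y) ==> adj x y].

Definition maximal_clique (G : sgraph) (A : {set G}) : bool :=
  maxset (@clique G) A.

Definition monochromatic (G : sgraph) (k : nat) (phi : G -> 'I_k)
    (A : {set G}) : Prop :=
  exists c : 'I_k, forall x : G, x \in A -> phi x = c.

Definition clique_coloring (G : sgraph) (k : nat) (phi : G -> 'I_k) : Prop :=
  forall A : {set G}, maximal_clique A -> 1 < #|A| -> ~ monochromatic phi A.

Definition clique_colorable (k : nat) (G : sgraph) : Prop :=
  exists phi : G -> 'I_k, clique_coloring phi.

(* Main.v *)
(** A [K_4]-minor-free graph has a vertex [v] of degree at most 2.  When the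
    graph is edge-maximal, the neighbours of [v] are adjacent: if [a] and [b]
    are non-adjacent neighbours, then adding [ab] creates a [K_4]-minor that
    can avoid [v], and [G] plus [ab] minus [v] is the contraction of [av] in
    [G].  For the same reason [G] minus [v] is again edge-maximal, so a
    colouring of it extends to [v] by giving [v] the colour opposite to that of
    one of its neighbours.  The invariant is that no triangle is monochromatic
    and every monochromatic edge lies in a triangle. *)

Require Import Defs.
From mathcomp Require Import all_boot.
From mathcomp Require Import zify.

Set Implicit Arguments.
Unset Strict Implicit.
Unset Printing Implicit Defensive.

(** * Branch-set models of minors *)

Lemma adj_neq (G : sgraph) (x y : G) : adj x y -> x != y.
Proof. by apply: contraTneq => ->; rewrite adj_irrefl. Qed.

Definition linked (G : sgraph) (A B : {set G}) : Prop :=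
  exists x y, [/\ x \in A, y \in B & adj x y].

(** Connectedness is phrased through cuts instead of paths, so that it passes along maps by pulling
    a cut back or pushing it forward. The empty set satisfies it; branch sets are nonempty by
    [model_onto]. *)
Definition connected_set (G : sgraph) (B : {set G}) : Prop :=
  forall A : {set G}, A \proper B -> A != set0 -> linked A (B :\: A).

Definition fibre (H G : sgraph) (r : G -> option H) (h : H) : {set G} :=
  [set x | r x == Some h].

(* [r] sends each vertex to the branch set containing it, and the vertices
   outside the model to [None]. *)
Record is_model (H G : sgraph) (r : G -> option H) : Prop := IsModel {
  model_onto : forall h, exists x, r x = Some h;
  model_conn : forall h, connected_set (fibre r h);
  model_adj : forall h k, adj h k -> linked (fibre r h) (fibre r k) }.

Definition model (H G : sgraph) : Prop := exists r : G -> option H, is_model r.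

Lemma connected_set1 (G : sgraph) (B : {set G}) :
  {in B &, forall x y, x = y} -> connected_set B.
Proof.
move=> inB A /properP[sAB [y yB yA]] /set0Pn[x xA].
by move: yA; rewrite -(inB x y) ?xA // (subsetP sAB).
Qed.

(** A cut of a composite branch set either splits some fibre of [q], whose connectedness gives the
    crossing edge, or is a union of fibres and projects to a cut of a fibre of [r], whose crossing
    edge lifts. *)
Lemma model_trans (H G K : sgraph) : model H G -> model G K -> model H K.
Proof.
move=> [r [r1 r2 r3]] [q [q1 q2 q3]]; exists (fun x => obind r (q x)); split.
- move=> h; have [y ry] := r1 h; have [x qx] := q1 y.
  by exists x; rewrite qx.
- move=> h A /properP[sAB [z zB zA]] /set0Pn[x xA].
  have fibB t y : q t = Some y ->
      (t \in fibre (fun x => obind r (q x)) h) = (y \in fibre r h).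
    by rewrite !inE => ->.
  (* First case: [A] splits the fibre of some [y]. *)
  have [/existsP[y /and3P[yB yA yC]]|] :=
    boolP [exists y in fibre r h, (A :&: fibre q y != set0)
                                  && (fibre q y :\: A != set0)].
    have [|s [t [sP tP st]]] := q2 y (A :&: fibre q y) _ yA.
      rewrite properE subsetIr /=; apply/subsetPn.
      by have [t] := set0Pn _ yC; rewrite !inE => /andP[? ?]; exists t;
        rewrite !inE // negb_and; apply/orP; left.
    exists s, t; split=> //; first by case/setIP: sP.
    move: tP; rewrite in_setD in_setI => /andP[tA tq].
    move: (tq); rewrite tq andbT in tA; rewrite inE => /eqP qt.
    by rewrite in_setD tA (fibB _ _ qt).
  rewrite negb_exists => /forallP nosplit.
  have same y s t : y \in fibre r h -> q s = Some y -> q t = Some y ->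
      s \in A -> t \in A.
    move=> yB qs qt sA; apply: contraT => tA.
    have := nosplit y; rewrite yB /= negb_and !negbK => /orP[] /eqP/setP E.
      by have := E s; rewrite !inE sA qs eqxx.
    by have := E t; rewrite !inE tA qt eqxx.
  have inq t : t \in fibre (fun x => obind r (q x)) h ->
      exists2 y, q t = Some y & y \in fibre r h.
    by rewrite inE; case qt: (q t) => [y|] //= ry; exists y; rewrite ?inE.
  (* No fibre is split, so [A] is the preimage of the cut [A']. *)
  pose A' := [set y in fibre r h | A :&: fibre q y != set0].
  have [||s [t [sP tP st]]] := r2 h A'.
  + rewrite properE; apply/andP; split.
      by apply/subsetP=> y; rewrite inE => /andP[].
    have [y qz yB] := inq z zB; apply/subsetPn; exists y => //.
    rewrite inE yB /= negbK; apply/eqP/setP=> t; rewrite !inE.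
    apply/andP=> -[tA /eqP qt].
    by rewrite (same y t z) in zA.
  + have [y qx yB] := inq x (subsetP sAB _ xA); apply/set0Pn; exists y.
    by rewrite inE yB; apply/set0Pn; exists x; rewrite !inE xA qx eqxx.
  have [s' [t' [sP' tP' st']]] := q3 _ _ st.
  move: sP'; rewrite inE => /eqP qs; move: tP'; rewrite inE => /eqP qt.
  exists s', t'; split=> //.
    move: sP; rewrite inE => /andP[sB /set0Pn[w]].
    rewrite !inE => /andP[wA /eqP qw].
    exact: same sB qw qs wA.
  move: tP; rewrite in_setD => /andP[tA tB].
  rewrite in_setD (fibB _ _ qt) tB andbT; apply: contra tA => tA.
  rewrite inE tB; apply/set0Pn; exists t'.
  by rewrite inE tA inE qt eqxx.
- move=> h k /r3[y [z [yh zk yz]]]; have [s [t [sy tz st]]] := q3 _ _ yz.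
  move: sy tz yh zk; rewrite !inE => /eqP qs /eqP qt /eqP ry /eqP rz.
  by exists s, t; rewrite !inE qs qt /= ry rz !eqxx.
Qed.

(* [c] contracts or deletes vertices without separating a branch set; a target
   [G'] with at least the edges of the quotient still carries the model. *)
Lemma model_quot (H G G' : sgraph) (r : G -> option H) (r' : G' -> option H)
    (c : G -> option G') :
  is_model r ->
  (forall x, r x = obind r' (c x)) ->
  (forall y, exists x, c x = Some y) ->
  (forall x y x' y', adj x y -> c x = Some x' -> c y = Some y' ->
     x' != y' -> adj x' y') ->
  is_model r'.
Proof.
move=> [r1 r2 r3] rc csurj cadj.
have inc x h : x \in fibre r h -> exists2 x', c x = Some x' & x' \in fibre r' h.
  rewrite inE rc; case E: (c x) => [x'|] //= ?; exists x' => //.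
  by rewrite inE.
split.
- move=> h; have [x rx] := r1 h.
  have [|x' _] := inc x h; first by rewrite inE rx.
  by rewrite inE => /eqP; exists x'.
- move=> h A /properP[sAB [z zB zA]] /set0Pn[x xA].
  have sub y y' : c y = Some y' -> y' \in fibre r' h -> y \in fibre r h.
    by rewrite !inE rc => ->.
  (* The cut [A] is pulled back along [c]. Adjacency survives [c] because the two ends of the
     crossing edge have distinct images. *)
  pose P := [set y | if c y is Some y' then y' \in A else false].
  have [||s [t [sP tP st]]] := r2 h P.
  + rewrite properE; apply/andP; split.
      apply/subsetP=> y; rewrite inE; case E: (c y) => [y'|] // yA.
      exact: sub E (subsetP sAB _ yA).
    have [z' cz] := csurj z; apply/subsetPn; exists z'; first exact: sub cz zB.
    by rewrite inE cz.
  + have [x' cx] := csurj x; apply/set0Pn; exists x'.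
    by rewrite inE cx.
  move: sP; rewrite inE; case cs: (c s) => [s'|] // sA.
  move: tP; rewrite in_setD => /andP[tA tB].
  have [t' ct tB'] := inc _ _ tB; move: tA; rewrite inE ct => tA.
  exists s', t'; split; rewrite ?in_setD ?tA //.
  apply: cadj st cs ct _; apply: contraNneq tA => <-.
  by [].
- move=> h k hk; have [s [t [sh tk st]]] := r3 _ _ hk.
  have [s' cs sh'] := inc _ _ sh; have [t' ct tk'] := inc _ _ tk.
  exists s', t'; split=> //; apply: cadj st cs ct _.
  apply: contraTneq hk => E; move: sh' tk'; rewrite E !inE => /eqP-> /eqP[->].
  by rewrite adj_irrefl.
Qed.

Lemma model_mono (H : sgraph) (T : finType) (e e' : rel T) es ei es' ei' :
  subrel e e' -> model H (@SGraph T e es ei) -> model H (@SGraph T e' es' ei').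
Proof.
move=> ee' [r rM]; exists r.
apply: (@model_quot _ _ (SGraph es' ei') r r (@Some T) rM) => //=; first by move=> y; exists y.
by move=> x y x' y' /ee' + [<-] [<-].
Qed.

Lemma model_iso (H G : sgraph) : isomorphic H G -> model H G.
Proof.
move=> [f [[g fK gK] fM]]; exists (fun x => Some (g x)); split.
- by move=> h; exists (f h); rewrite fK.
- move=> h; apply: connected_set1 => x y; rewrite !inE => /eqP[<-] /eqP[E].
  exact: esym (can_inj gK E).
- by move=> h k hk; exists (f h), (f k); rewrite !inE !fK fM.
Qed.

Lemma model_del_vertex (G : sgraph) (v : G) : model (del_vertex v) G.
Proof.
exists insub; split.
- by move=> h; exists (val h); rewrite valK.
- move=> h; apply: connected_set1 => x y; rewrite !inE => /eqP E /eqP F.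
  by move: E F; case: insubP => // ? _ <- [->]; case: insubP => // ? _ <- [->].
- by move=> h k hk; exists (val h), (val k); rewrite !inE !valK.
Qed.

(** The merged vertex has branch set [{u, v}], connected by the edge [uv]; all other branch sets are
    singletons. *)
Lemma model_contract_edge (G : sgraph) (u v : G) :
  adj u v -> model (contract_edge u v) G.
Proof.
move=> uv; have nuv := adj_neq uv.
pose u' : contract_edge u v := Sub u nuv.
pose r x : option (contract_edge u v) := if x == v then Some u' else insub x.
have rval h : r (val h) = Some h.
  by rewrite /r (negbTE (valP h)) valK.
have rv : r v = Some u' by rewrite /r eqxx.
exists r; split.
- by move=> h; exists (val h).
- move=> h A /properP[sAB [y yB yA]] /set0Pn[x xA].
  have fib t : t \in fibre r h -> t = val h \/ t = v /\ h = u'.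
    rewrite inE /r; case: (t =P v) => [-> /eqP[<-]|_]; first by right.
    by case: insubP => // t' _ <- /eqP[->]; left.
  have [xB nxy] : x \in fibre r h /\ x != y.
    by split; [exact: (subsetP sAB)|apply: contraNneq yA => <-].
  exists x, y; split; rewrite ?in_setD ?yA //.
  have [ex|[ex eh]] := fib x xB; have [ey|[ey eh']] := fib y yB.
  + by rewrite ex ey eqxx in nxy.
  + by rewrite ex ey eh'.
  + by rewrite ex ey eh adj_sym.
  + by rewrite ex ey eqxx in nxy.
- move=> h k /andP[_ /or3P[hk|/andP[/eqP eh vk]|/andP[/eqP ek vh]]].
  + by exists (val h), (val k); rewrite !inE !rval.
  + exists v, (val k); rewrite !inE rval rv vk; split=> //.
    by apply/eqP; congr Some; apply: val_inj.
  + exists (val h), v; rewrite !inE rval rv adj_sym vh; split=> //.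
    by apply/eqP; congr Some; apply: val_inj.
Qed.

Lemma minor_model (H G : sgraph) : minor H G -> model H G.
Proof.
elim=> {G} [G /model_iso //|G u v uv _|G v _ IH|G u v uv _ IH].
- case: G u v uv => T e es ei u v uv; apply: model_mono => x y.
  by case/andP.
- exact: model_trans IH (model_del_vertex v).
- exact: model_trans IH (model_contract_edge uv).
Qed.

(** * From models of complete graphs back to minors *)

Lemma is_model_del_vertex (H G : sgraph) (r : G -> option H) (v : G) :
  is_model r -> r v = None ->
  is_model (fun x : del_vertex v => r (val x)).
Proof.
move=> rM rv.
apply: (model_quot (c := fun x => insub x : option (del_vertex v)) rM).
- by move=> x; case: insubP => [x' _ <- //|]; rewrite negbK => /eqP->.
- by move=> y; exists (val y); rewrite valK.
move=> x y x' y' xy; case: insubP => // x1 _ ex [<-]; case: insubP => // y1 _ ey [<-].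
by rewrite /= /del_vertex_adj ex ey.
Qed.

(** The relation [e] is left abstract to cover two cases: contraction of the edge [uv], and deletion
    of a vertex [v] whose neighbours are pairwise adjacent. *)
Lemma is_model_merge (H G : sgraph) (r : G -> option H) (u v : G)
    (e : rel {x : G | x != v}) es ei :
  is_model r -> r u = r v -> u != v ->
  (forall x y, adj (val x) (val y) -> e x y) ->
  (forall x y, val x = u -> x != y -> adj v (val y) -> e x y) ->
  is_model (fun x : @SGraph {x : G | x != v} e es ei => r (val x)).
Proof.
move=> rM ruv nuv e1 e2; pose u' : {x : G | x != v} := Sub u nuv.
pose c x : option {x : G | x != v} := if x == v then Some u' else insub x.
apply: (@model_quot _ _ (SGraph es ei) r (fun x => r (val x)) c rM).
- rewrite /c => x; case: eqP => [->|/eqP nxv]; first by rewrite /= ruv.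
  by case: insubP => [x' _ <- //|]; rewrite nxv.
- by move=> y; exists (val y); rewrite /c (negbTE (valP y)) valK.
move=> x y x' y'; rewrite /c.
case: (x =P v) => [->|/eqP nxv]; case: (y =P v) => [->|/eqP nyv].
- by rewrite adj_irrefl.
- move=> vy [<-]; case: insubP => // y1 _ ey [<-] n.
  by apply: e2; rewrite ?ey.
- rewrite adj_sym => vx; case: insubP => // x1 _ ex [<-] [<-] n.
  by rewrite adj_sym; apply: e2; rewrite 1?eq_sym ?ex.
- move=> xy; case: insubP => // x1 _ ex [<-]; case: insubP => // y1 _ ey [<-] _.
  by apply: e1; rewrite ex ey.
Qed.

Lemma card_neq (T : finType) (v : T) : #|{: {x : T | x != v}}| < #|T|.
Proof.
rewrite card_sig (eq_card (B := predC1 v)) // cardC1 prednK //.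
by apply/card_gt0P; exists v.
Qed.

(** Induction on the number of vertices: delete a vertex outside the model, or contract an edge
    inside a branch set with at least two vertices, until [r] is a bijection. *)
Lemma model_complete_minor (n : nat) (G : sgraph) :
  model (complete_graph n) G -> minor (complete_graph n) G.
Proof.
have [m] := ubnP #|G|; elim: m G => // m IH G ltGm [r rM].
have card_del v : #|{: {x : G | x != v}}| < m.
  by apply: leq_trans (card_neq v) _.
have [/existsP[v /eqP rv]|] := boolP [exists v, r v == None].
  apply: (minor_del_vertex (v := v)); apply: IH; first exact: card_del.
  by eexists; apply: is_model_del_vertex rM rv.
rewrite negb_exists => /forallP rtot.
have [/existsP[v /existsP[w /andP[nvw /eqP rvw]]]|] :=
    boolP [exists v, exists w, (v != w) && (r v == r w)].
  case rv: (r v) => [h|]; last by have := rtot v; rewrite rv.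
  (* The cut isolating [v] yields a neighbour of [v] in its own branch set. *)
  have [||s [u [sv + vu]]] := model_conn rM (h := h) (A := [set v]).
  - rewrite properE sub1set inE rv eqxx; apply/subsetPn; exists w.
      by rewrite inE -rvw rv.
    by rewrite inE eq_sym.
  - by apply/set0Pn; exists v; rewrite inE.
  move: sv vu; rewrite !inE => /eqP-> vu /andP[nuv /eqP ru].
  have uv : adj u v by rewrite adj_sym.
  apply: (minor_contract_edge uv); apply: IH; first exact: card_del.
  exists (fun x : contract_edge u v => r (val x)).
  apply: (is_model_merge _ _ rM) nuv _ _; first by rewrite ru rv.
    move=> x y xy; rewrite /contract_adj xy andbT.
    by apply: contraTneq xy => ->; rewrite adj_irrefl.
  by move=> x y eu nxy vy; rewrite /contract_adj nxy eu eqxx vy orbT.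
rewrite negb_exists => /forallP rinj.
have {}rinj : injective r.
  move=> x y E; have := rinj x; rewrite negb_exists => /forallP/(_ y).
  by rewrite E eqxx andbT negbK => /eqP.
(* All branch sets are singletons. As the target is complete, [G] has no surplus edges to delete. *)
apply: minor_iso.
have ex h : {x | r x == Some h}.
  by apply: sigW; have [x rx] := model_onto rM h; exists x; apply/eqP.
have ex' x : {h | r x == Some h}.
  by apply: sigW; have := rtot x; case: (r x) => // h; exists h.
pose f h := sval (ex h); pose g x := sval (ex' x).
have rf h : r (f h) = Some h by apply/eqP/(svalP (ex h)).
have rg x : r x = Some (g x) by apply/eqP/(svalP (ex' x)).
exists f; split.
  exists g; first by move=> h; apply: Some_inj; rewrite -rg rf.
  by move=> x; apply: rinj; rewrite rf rg.
move=> h k; apply/idP/idP => [hk|].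
  by apply: contraTneq hk => ->; rewrite adj_irrefl.
case/(model_adj rM) => s [t []]; rewrite !inE => /eqP rs /eqP rt.
by rewrite (rinj (f h) s) ?rf // (rinj (f k) t) ?rf.
Qed.

Lemma model_clique (n : nat) (G : sgraph) (t : 'I_n -> G) :
  (forall i j, i != j -> adj (t i) (t j)) -> model (complete_graph n) G.
Proof.
move=> tadj; pose r x : option (complete_graph n) := [pick i | t i == x].
have tinj : injective t.
  move=> i j E; apply/eqP; apply: contraT => /tadj.
  by rewrite E adj_irrefl.
have rt i : r (t i) = Some i.
  rewrite /r; case: pickP => [j /eqP/tinj -> //|/(_ i)].
  by rewrite eqxx.
have fib x i : x \in fibre r i -> x = t i.
  by rewrite inE /r; case: pickP => // j /eqP <- /eqP[->].
exists r; split; first by move=> i; exists (t i).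
  by move=> i; apply: connected_set1 => x y /fib-> /fib->.
by move=> i j ij; exists (t i), (t j); rewrite !inE !rt !eqxx tadj.
Qed.

(** * Degrees, simplicial vertices and graphs of minimum degree 3 *)

Definition nbrs (G : sgraph) (x : G) : {set G} := [set y | adj x y].

Definition deg (G : sgraph) (x : G) : nat := #|nbrs x|.

(** Trading cardinals for a neighbour outside any short list makes degree bounds easy to move
    between a graph and its contraction, whose vertex types differ. *)
Lemma deg_gtP (G : sgraph) (x : G) (k : nat) :
  k < deg x <->
  forall s : seq G, size s <= k -> exists2 c, adj x c & c \notin s.
Proof.
split=> [ltk s les|ex].
  have : ~~ (nbrs x \subset s).
    apply: contraTN ltk => /subset_leq_card; rewrite -leqNgt => /leq_trans->//.
    exact: leq_trans (card_size s) les.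
  by case/subsetPn=> c; rewrite inE; exists c.
rewrite ltnNge; apply/negP=> lek.
have [|c xc] := ex (enum (nbrs x)); first by rewrite -cardE.
by rewrite mem_enum inE xc.
Qed.

Lemma nbrs_mem (G : sgraph) (x : G) (s : seq G) :
  uniq s -> all (adj x) s -> deg x <= size s -> forall y, adj x y -> y \in s.
Proof.
move=> us /allP als le y xy.
have /eqP E : [set z in s] == nbrs x.
  rewrite eqEcard; apply/andP; split.
    by apply/subsetP=> z; rewrite !inE => /als.
  by rewrite [#|finset _|]cardsE (card_uniqP us).
by move/setP/(_ y): E; rewrite !inE xy.
Qed.

(* A branch set containing [v] has another vertex, since [v] alone has too few
   neighbours, and [v] can be merged into a neighbour in its branch set. *)
Lemma model_del_simplicial (n : nat) (G : sgraph) (v : G) :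
  (forall x y, adj v x -> adj v y -> x != y -> adj x y) -> deg v < n ->
  model (complete_graph n.+1) G -> model (complete_graph n.+1) (del_vertex v).
Proof.
move=> simp degv [r rM].
case rv: (r v) => [h|]; last by eexists; apply: is_model_del_vertex rM rv.
exists (fun x : del_vertex v => r (val x)).
have [/existsP[w /andP[nwv /eqP rw]]|] := boolP [exists w, (w != v) && (r w == Some h)].
  have [||s [u [sv + vu]]] := model_conn rM (h := h) (A := [set v]).
  - rewrite properE sub1set inE rv eqxx; apply/subsetPn; exists w.
      by rewrite inE rw.
    by rewrite inE.
  - by apply/set0Pn; exists v; rewrite inE.
  move: sv vu; rewrite !inE => /eqP-> vu /andP[nuv /eqP ru].
  apply: (is_model_merge _ _ rM) nuv _ _; first by rewrite ru rv.
    by [].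
  move=> x y eu nxy vy; apply: simp => //; first by rewrite eu.
rewrite negb_exists => /forallP single.
have : [set Some k | k in [set~ h]] \subset r @: nbrs v.
  apply/subsetP=> o /imsetP[k]; rewrite !inE => nkh ->.
  have [|s [t [sh tk st]]] := model_adj rM (h := h) (k := k).
    by rewrite /= /complete_adj eq_sym.
  apply/imsetP; exists t; last by move: tk; rewrite inE => /eqP.
  move: sh; rewrite inE => rs; have := single s.
  by rewrite rs andbT negbK => /eqP <-; rewrite inE.
move/subset_leq_card; rewrite card_imset; last by move=> ? ? [].
rewrite cardsC1 card_ord /= => /leq_trans/(_ (leq_imset_card _ _)).
by rewrite leqNgt degv.
Qed.

(** The merged vertex keeps the neighbours of [v] and [w] other than these two, at least three by
    the inequality. A common neighbour loses one neighbour, and any other vertex keeps its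
    degree. *)
Lemma contract_min_degree (G : sgraph) (v w : G) :
  (forall x : G, 2 < deg x) -> adj v w ->
  (forall c, adj v c -> adj w c -> 3 < deg c) ->
  #|nbrs v :&: nbrs w| + 5 <= deg v + deg w ->
  forall x : contract_edge v w, 2 < deg x.
Proof.
move=> min3 vw comm large x; apply/deg_gtP => s les.
have nvw := adj_neq vw.
pose s' := map val s; have les' : size s' <= 2 by rewrite size_map.
suff [c [ncw cs [nxc cx]]] : exists c, [/\ c != w, c \notin s' & val x != c /\
    [|| adj (val x) c, (val x == v) && adj w c | (c == v) && adj w (val x)]].
  exists (Sub c ncw); rewrite /= /contract_adj.
    by rewrite -val_eqE /= nxc cx.
  by apply: contra cs => cs; apply/mapP; exists (Sub c ncw).
have [exv|nxv] := eqVneq (val x) v.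
  pose U := (nbrs v :|: nbrs w) :\: [set v; w].
  have cardU : 2 < #|U|.
    have := cardsUI (nbrs v) (nbrs w).
    have := cardsID [set v; w] (nbrs v :|: nbrs w); rewrite -/U.
    have : #|(nbrs v :|: nbrs w) :&: [set v; w]| <= 2.
      by apply: leq_trans (subset_leq_card (subsetIr _ _)) _; rewrite cards2 nvw.
    move: large; rewrite -/(deg v) -/(deg w); lia.
  have /subsetPn[c] : ~~ (U \subset s').
    apply: contraL cardU => /subset_leq_card; rewrite -leqNgt => /leq_trans->//.
    exact: leq_trans (card_size _) les'.
  rewrite !inE negb_or => /andP[/andP[ncv ncw] vcw] cs; exists c.
  split=> //; rewrite exv; split; first by rewrite eq_sym.
  by case/orP: vcw => ->; rewrite ?orbT.
have [xw|nxw] := boolP (adj (val x) w); last first.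
  have [c xc cs] := (deg_gtP _ _).1 (min3 (val x)) s' les'.
  exists c; split=> //; last by rewrite xc (adj_neq xc).
  by apply: contraTneq xc => ->.
have [xv|nxv'] := boolP (adj (val x) v).
  have d4 : 3 < deg (val x) by apply: comm; rewrite adj_sym.
  have [//|c xc] := (deg_gtP _ _).1 d4 (w :: s').
  rewrite inE negb_or => /andP[ncw cs].
  by exists c; split=> //; rewrite xc (adj_neq xc).
(* Here [val x] is adjacent to [w] but not to [v], so [v] replaces [w] as a neighbour. If [v] is in
   [s'], it excludes no old neighbour and its slot can be given to [w]. *)
have [vs|nvs] := boolP (v \in s'); last first.
  by exists v; split=> //; split=> //; rewrite eqxx (adj_sym w (val x)) xw !orbT.
have [|c xc] := (deg_gtP _ _).1 (min3 (val x)) (w :: rem v s').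
  by rewrite /= size_rem // -ltnS prednK ?ltnS //; case: (s') vs.
rewrite inE negb_or => /andP[ncw cs].
have ncv : c != v by apply: contraTneq xc => ->.
exists c; split=> //; last by rewrite xc (adj_neq xc).
apply: contra cs => cs; have := perm_to_rem vs => /perm_mem/(_ c).
by rewrite cs inE (negbTE ncv).
Qed.

(* In a smallest counterexample no edge contraction preserves minimum degree 3,
   so every edge lies in a triangle and there is a vertex [w] of degree 3.  Its
   neighbours induce a path [p u q]; then [u] has degree 3 and [p], [q] have
   degree at least 4, so replacing [u] and [w] by the edge [pq] preserves
   minimum degree 3. *)
Lemma min_degree3_minor (G : sgraph) (x0 : G) :
  (forall x : G, 2 < deg x) -> minor (complete_graph 4) G.
Proof.
have [m] := ubnP #|G|; elim: m G x0 => // m IH G x0 ltGm min3.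
have red (v w : G) : adj v w -> (forall c, adj v c -> adj w c -> 3 < deg c) ->
    #|nbrs v :&: nbrs w| + 5 <= deg v + deg w -> minor (complete_graph 4) G.
  move=> vw comm large; apply: (minor_contract_edge vw).
  apply: IH (contract_min_degree min3 vw comm large).
    by exists v; apply: adj_neq.
  exact: leq_trans (card_neq w) _.
(* An edge in no triangle can be contracted, as [0 + 5 <= 3 + 3]. *)
have [/existsP[v /existsP[w /andP[vw /forallP nocomm]]]|] :=
    boolP [exists v : G, exists w : G,
             adj v w && [forall c, ~~ (adj v c && adj w c)]].
  apply: (red v w vw) => [c vc wc|]; first by have := nocomm c; rewrite vc wc.
  rewrite (_ : _ :&: _ = set0) ?cards0; last first.
    by apply/setP=> c; rewrite !inE (negbTE (nocomm c)).
  by have := min3 v; have := min3 w; lia.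
rewrite negb_exists => /forallP comm.
have {}comm (v w : G) : adj v w -> exists2 c, adj v c & adj w c.
  move=> vw; have := comm v; rewrite negb_exists => /forallP/(_ w).
  by rewrite vw negb_forall => /existsP[c]; rewrite negbK => /andP[]; exists c.
have [/existsP[w /eqP degw]|] := boolP [exists w : G, deg w == 3]; last first.
  rewrite negb_exists => /forallP no3.
  have min4 (x : G) : 3 < deg x by rewrite ltn_neqAle eq_sym no3 min3.
  (* With all degrees at least 4 any edge at [x0] can be contracted: the common neighbours number at
     most [deg w - 1], and [deg x0] contributes at least 4. *)
  have [w vw _] := (deg_gtP x0 2).1 (min3 x0) [::] isT.
  apply: (red x0 w vw) => // ; have := min4 x0.
  have : #|nbrs x0 :&: nbrs w| < deg w.
    apply: proper_card; rewrite properE subsetIr; apply/subsetPn; exists x0.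
      by rewrite inE adj_sym.
    by rewrite !inE adj_irrefl.
  lia.
have centre (u p q : G) : uniq [:: u; p; q] -> all (adj w) [:: u; p; q] ->
    adj u p -> adj u q -> minor (complete_graph 4) G.
  move=> upq wupq up uq; have Nw := nbrs_mem upq wupq (eq_leq degw).
  have [wu wp wq] : [/\ adj w u, adj w p & adj w q].
    by case/and4P: wupq.
  have [pq|npq] := boolP (adj p q).
    apply: model_complete_minor.
    apply: (@model_clique 4 G (fun i => nth w [:: w; u; p; q] i)).
    by case=> [[|[|[|[|//]]]] ?] [[|[|[|[|//]]]] ?] //= _; rewrite // adj_sym.
  have npq' : p != q by move: upq; rewrite /= !inE; case/and3P.
  have pw : adj p w by rewrite adj_sym.
  have Nu0 (c : G) : adj p c -> adj w c -> c = u.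
    move=> pc /Nw; rewrite !inE => /or3P[] /eqP // E; move: pc; rewrite E.
      by rewrite adj_irrefl.
    by rewrite (negbTE npq).
  (* Since [u] is the only common neighbour of [p] and [w], degree at least 4 at [u] makes [pw]
     contractible. Otherwise the neighbours of [u] are exactly [w], [p], [q]. *)
  have [degu|] := ltnP 3 (deg u).
    apply: (red p w pw) => [c pc wc|]; first by rewrite (Nu0 c).
    have : #|nbrs p :&: nbrs w| <= #|[set u]|.
      by apply/subset_leq_card/subsetP=> c; rewrite !inE => /andP[? ?]; apply/eqP/Nu0.
    by rewrite cards1; have := min3 p; lia.
  have uwpq : uniq [:: w; p; q].
    by rewrite /= !inE negb_or (adj_neq wp) (adj_neq wq) npq'.
  have uw : adj u w by rewrite adj_sym.
  move/(nbrs_mem uwpq) => /=; rewrite uw up uq => /(_ isT) Nu.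
  (* If [p'] had degree 3, let [y] be its neighbour other than [u] and [w]. A triangle on the edge
     [p'y] has its apex at [u] or [w], but all neighbours of these are known and [y] is not among
     them. *)
  have deg4 (p' q' : G) : ~~ adj p' q' -> adj u p' -> adj w p' ->
      (forall c, adj u c -> c \in [:: w; p'; q']) ->
      (forall c, adj w c -> c \in [:: u; p'; q']) -> 3 < deg p'.
    move=> npq1 up1 wp1 Nu1 Nw1; rewrite ltnNge; apply/negP=> le3.
    have [y py] := (deg_gtP p' 2).1 (min3 p') [:: u; w] isT.
    rewrite !inE negb_or => /andP[nyu nyw].
    have nyp : y != p' by rewrite eq_sym adj_neq.
    have nyq : y != q' by apply: contraNneq npq1 => <-.
    have [c pc yc] := comm _ _ py.
    have : c \in [:: u; w; y].
      apply: nbrs_mem pc => //=; last by rewrite ![adj p' _]adj_sym up1 wp1 adj_sym py.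
      by rewrite !inE negb_or adj_neq // eq_sym nyu eq_sym nyw.
    rewrite !inE => /or3P[] /eqP E; move: yc; rewrite E.
    + by rewrite adj_sym => /Nu1; rewrite !inE (negbTE nyw) (negbTE nyp) (negbTE nyq).
    + by rewrite adj_sym => /Nw1; rewrite !inE (negbTE nyu) (negbTE nyp) (negbTE nyq).
    + by rewrite adj_irrefl.
  have degp : 3 < deg p by apply: deg4 npq up wp Nu Nw.
  have degq : 3 < deg q.
    apply: (deg4 q p) => //; first by rewrite adj_sym npq.
      by move=> c /Nu; rewrite !inE [(_ == p) || _]orbC.
    by move=> c /Nw; rewrite !inE [(_ == p) || _]orbC.
  (* Contracting [pw] into [p] creates the edge [pq], and deleting [u] then leaves [G] without [u]
     and [w], plus [pq]. *)
  apply: (minor_contract_edge pw).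
  pose u' : contract_edge p w := Sub u (adj_neq uw).
  apply: (minor_del_vertex (v := u')).
  have nqu : q != u by rewrite eq_sym adj_neq.
  have nqw : q != w by rewrite eq_sym adj_neq.
  have npu : p != u by rewrite eq_sym adj_neq.
  have npw : p != w by apply: adj_neq.
  have inH (c : G) : c != w -> c != u -> exists c' : del_vertex u', val (val c') = c.
    by move=> cw cu; exists (Sub (Sub c cw : contract_edge p w) cu).
  apply: IH.
  - exact: (Sub (Sub p npw : contract_edge p w) npu).
  - apply: leq_trans (card_neq _) _; apply: ltnW.
    exact: leq_trans (card_neq w) _.
  move=> x; apply/deg_gtP=> s les.
  pose s' := map (fun y : del_vertex u' => val (val y)) s.
  have les' : size s' <= 2 by rewrite size_map.
  pose X := val (val x).
  have nXw : X != w := valP (val x).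
  have nXu : X != u by have := valP x; rewrite -val_eqE.
  suff [c [ncw ncu cs nXc cx]] : exists c, [/\ c != w, c != u, c \notin s', X != c &
      [|| adj X c, (X == p) && adj w c | (c == p) && adj w X]].
    have [c' ec] := inH c ncw ncu; exists c'.
      by rewrite /= /del_vertex_adj /= /contract_adj -val_eqE ec nXc cx.
    by apply: contra cs => cs; apply/mapP; exists c'.
  (* The vertex [a] may lose [w] and [u]. As [b] is not adjacent to [a], its slot in [s'] is free:
     [w], [u] and the rest of [s'] are at most three vertices, fewer than [deg a]. *)
  have swap (a b : G) : 3 < deg a -> ~~ adj a b -> b \in s' ->
      exists c, [/\ c != w, c != u, c \notin s' & adj a c].
    move=> dega nab bs.
    have [|c ac] := (deg_gtP a 3).1 dega (w :: u :: rem b s').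
      by rewrite /= size_rem //; case: (s') bs les'.
    rewrite !inE !negb_or => /and3P[ncw ncu cs]; exists c; split=> //.
    have ncb : c != b by apply: contraNneq nab => <-.
    apply: contra cs => cs; have := perm_to_rem bs => /perm_mem/(_ c).
    by rewrite cs inE (negbTE ncb).
  have [EX|nXp] := eqVneq X p.
    rewrite EX; have [qs|nqs] := boolP (q \in s').
      have [c [ncw ncu cs pc]] := swap p q degp npq qs.
      by exists c; rewrite pc; split=> //; apply: adj_neq.
    by exists q; rewrite wq orbT.
  have [EX|nXq] := eqVneq X q.
    rewrite EX; have [ps|nps] := boolP (p \in s').
      have [|c [ncw ncu cs pc]] := swap q p degq _ ps; first by rewrite adj_sym npq.
      by exists c; rewrite pc; split=> //; apply: adj_neq.
    by exists p; split=> //; [rewrite eq_sym|rewrite eqxx wq !orbT].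
  (* Any other vertex is adjacent to neither [u] nor [w] and keeps all its neighbours. *)
  have [c Xc cs] := (deg_gtP X 2).1 (min3 X) s' les'.
  exists c; rewrite Xc; split=> //; last exact: adj_neq.
    apply: contraTneq Xc => ->; rewrite adj_sym; apply/negP=> /Nw.
    by rewrite !inE (negbTE nXu) (negbTE nXp) (negbTE nXq).
  apply: contraTneq Xc => ->; rewrite adj_sym; apply/negP=> /Nu.
  by rewrite !inE (negbTE nXw) (negbTE nXp) (negbTE nXq).
have : size (enum (nbrs w)) = 3 by rewrite -cardE.
have := enum_uniq (nbrs w); have inN (y : G) : (y \in enum (nbrs w)) = adj w y.
  by rewrite mem_enum inE.
case: (enum _) inN => [|x [|y [|z [|//]]]] //= inN uxyz _.
have {}uxyz : uniq [:: x; y; z] by [].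
have wxyz : all (adj w) [:: x; y; z] by apply/allP=> t; rewrite inN.
have perm_centre (u p q : G) : perm_eq [:: x; y; z] [:: u; p; q] ->
    adj u p -> adj u q -> minor (complete_graph 4) G.
  by move=> E; apply: centre; rewrite -?(perm_uniq E) -?(perm_all _ E).
(* Each edge [wt] lies in a triangle, so none of the three neighbours of [w] is isolated among them;
   hence one is adjacent to the other two. *)
have isol (t : G) : t \in [:: x; y; z] -> has (adj t) [:: x; y; z].
  by rewrite inN => /comm[c wc tc]; apply/hasP; exists c; rewrite ?inN.
have := isol x; have := isol y; have := isol z.
rewrite !inE !eqxx !orbT /= !adj_irrefl !orbF => /(_ isT) hz /(_ isT) hy /(_ isT) hx.
have [xy|nxy] := boolP (adj x y).
  have [xz|nxz] := boolP (adj x z); first exact: perm_centre xy xz.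
  apply: (perm_centre y x z); rewrite 1?adj_sym //.
    by rewrite -(perm_rot 1) /= perm_cons -(perm_rot 1).
  by move: hz; rewrite adj_sym (negbTE nxz) adj_sym.
apply: (perm_centre z x y); first by rewrite -(perm_rot 2).
  by rewrite adj_sym; move: hx; rewrite (negbTE nxy).
by rewrite adj_sym; move: hy; rewrite adj_sym (negbTE nxy).
Qed.

(** * Vertices of degree at most 2 in edge-maximal graphs *)

(** Adding [ab] leaves the neighbours of [v] unchanged but makes them adjacent, so
    [model_del_simplicial] applies to [v] in the enlarged graph. *)
Lemma edge_maximal_simplicial (G : sgraph) (v a b : G) :
  edge_maximal_minor_free (complete_graph 4) G -> deg v <= 2 ->
  adj v a -> adj v b -> a != b -> adj a b.
Proof.
move=> [free maxG] degv va vb nab; apply: contraT => /(maxG _ _ nab)/minor_model.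
have Nv : forall x, adj v x -> x \in [:: a; b].
  by apply: nbrs_mem; rewrite ?va ?vb //= ?inE ?nab ?va ?vb.
have nva := adj_neq va; have nvb := adj_neq vb.
have Nv' (x : G) : add_edge_adj a b v x -> adj v x.
  rewrite /add_edge_adj /same_pair (negbTE nva) (negbTE nvb) /= orbF.
  by case/andP.
move/(@model_del_simplicial 3 (add_edge a b) v) => mdl; case: free.
have av : adj a v by rewrite adj_sym.
apply: (minor_contract_edge av); apply: model_complete_minor.
apply: (model_mono _ _ _ (mdl _ _)).
- move=> x y /andP[nxy]; rewrite /contract_adj nxy.
  case/orP=> [-> //|/orP[]/andP[/eqP-> /eqP->]]; rewrite eqxx vb ?orbT //.
- move=> x y /Nv'/Nv + /Nv'/Nv + nxy.
  rewrite !inE /= /add_edge_adj /same_pair nxy /=.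
  by case/orP=> /eqP Ex /orP[]/eqP Ey; move: nxy; rewrite Ex Ey !eqxx ?orbT.
- apply: leq_ltn_trans (_ : deg v < 3); last by [].
  by apply/subset_leq_card/subsetP=> x; rewrite !inE; apply: Nv'.
Qed.

(** The neighbours of [v] are pairwise adjacent and remain so after adding an edge away from [v], so
    the resulting [K_4]-model can be moved off [v]. *)
Lemma edge_maximal_del_vertex (G : sgraph) (v : G) :
  edge_maximal_minor_free (complete_graph 4) G -> deg v <= 2 ->
  edge_maximal_minor_free (complete_graph 4) (del_vertex v).
Proof.
move=> eG degv; have [free maxG] := eG; split.
  by move=> mG; apply: free; apply: minor_del_vertex mG.
move=> x y nxy nadj; apply: model_complete_minor.
have /minor_model := maxG (val x) (val y) nxy nadj.
have nvx : v != val x by rewrite eq_sym (valP x).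
have nvy : v != val y by rewrite eq_sym (valP y).
have Nv (z : G) : add_edge_adj (val x) (val y) v z -> adj v z.
  rewrite /add_edge_adj /same_pair (negbTE nvx) (negbTE nvy) /= orbF.
  by case/andP.
move/(@model_del_simplicial 3 (add_edge (val x) (val y)) v) => mdl.
apply: (model_mono _ _ _ (mdl _ _)).
- by move=> s t /andP[nst]; rewrite /add_edge_adj nst.
- move=> s t /Nv vs /Nv vt nst; rewrite /= /add_edge_adj nst.
  by rewrite (edge_maximal_simplicial eG degv vs vt nst).
- apply: leq_ltn_trans (_ : deg v < 3); last by [].
  by apply/subset_leq_card/subsetP=> z; rewrite !inE; apply: Nv.
Qed.

(** * The colouring *)

Definition no_mono_triangle (G : sgraph) (phi : G -> bool) : Prop :=
  forall x y z, adj x y -> adj x z -> adj y z ->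
  phi x = phi y -> phi x = phi z -> False.

Definition mono_edge_in_triangle (G : sgraph) (phi : G -> bool) : Prop :=
  forall x y, adj x y -> phi x = phi y -> exists2 z, adj x z & adj y z.

Lemma edge_maximal_bicoloring (G : sgraph) :
  edge_maximal_minor_free (complete_graph 4) G ->
  exists2 phi : G -> bool, no_mono_triangle phi & mono_edge_in_triangle phi.
Proof.
have [m] := ubnP #|G|; elim: m G => // m IH G ltGm eG.
have [x0 _|G0] := pickP (@predT G); last first.
  by exists (fun=> true) => x; have := G0 x.
have [v degv] : exists v : G, deg v <= 2.
  have [/existsP//|] := boolP [exists v : G, deg v <= 2].
  rewrite negb_exists => /forallP min3; case: eG => -[].
  by apply: (min_degree3_minor x0) => x; rewrite ltnNge min3.
have simp a b := @edge_maximal_simplicial G v a b eG degv.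
have [|psi psiT psiE] := IH (del_vertex v) _ (edge_maximal_del_vertex eG degv).
  exact: leq_trans (card_neq v) _.
pose psi' x := if insub x is Some x' then psi x' else true.
have psi'E x (nxv : x != v) : psi' x = psi (Sub x nxv).
  by rewrite /psi' insubT.
(* The colour of [v] is opposite to that of a chosen neighbour, and [true] if [v] is isolated. *)
pose cv := if [pick a | adj v a] is Some a then ~~ psi' a else true.
pose phi x := if x == v then cv else psi' x.
have phiv : phi v = cv by rewrite /phi eqxx.
have phiN (x : G) : x != v -> phi x = psi' x by rewrite /phi => /negbTE->.
have vN (x : G) : adj v x -> x != v by move/adj_neq; rewrite eq_sym.
have opp (x : G) : adj v x -> exists2 a, adj v a & phi a = ~~ phi v.
  move=> vx; rewrite phiv /cv; case: pickP => [a va|/(_ x)]; last by rewrite vx.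
  by exists a; rewrite // phiN ?vN // negbK.
(* In a triangle [vxy], the vertices [x] and [y] are all the neighbours of [v], and one of them has
   the opposite colour. *)
have triv (x y : G) : adj v x -> adj v y -> adj x y ->
    phi v = phi x -> phi v = phi y -> False.
  move=> vx vy xy ex ey; have [a va ea] := opp x vx.
  have : a \in [:: x; y].
    by apply: nbrs_mem va; rewrite //= ?vx ?vy // inE adj_neq.
  by rewrite !inE => /orP[]/eqP E; move: ea; rewrite E -?ex -?ey; case: (phi v).
(* The oppositely coloured neighbour [a] differs from [y], hence is adjacent to it and completes a
   triangle. *)
have edgev (y : G) : adj v y -> phi v = phi y -> exists2 z, adj v z & adj y z.
  move=> vy ey; have [a va ea] := opp y vy; exists a => //.
  by apply: simp => //; apply: contra_eq_neq ea => <-; rewrite -ey; case: (phi v).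
exists phi.
- move=> x y z xy xz yz exy exz.
  have [Ex|nx] := eqVneq x v; first by subst x; exact: triv xy xz yz exy exz.
  have [Ey|ny] := eqVneq y v.
    subst y; apply: (triv x z) => //; first by rewrite adj_sym.
    by rewrite -exy.
  have [Ez|nz] := eqVneq z v.
    by subst z; apply: (triv x y); rewrite // 1?adj_sym // -exz.
  move: exy exz; rewrite !phiN // !psi'E.
  exact: psiT.
- move=> x y xy exy.
  have [Ex|nx] := eqVneq x v; first by subst x; exact: edgev.
  have [Ey|ny] := eqVneq y v.
    subst y; have vx : adj v x by rewrite adj_sym.
    by have [z vz xz] := edgev x vx (esym exy); exists z.
  move: exy; rewrite !phiN // !psi'E => /psiE[//|z xz yz].
  by exists (val z).
Qed.

Theorem theorem3p1 (G : sgraph)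
    (hG : edge_maximal_minor_free (complete_graph 4) G) :
  clique_colorable 2 G.
Proof.
have [phi phiT phiE] := edge_maximal_bicoloring hG.
exists (fun x => inord (phi x)) => A /maxsetP[/forallP clA maxA] A2 [c mono].
have phi_eq x y : x \in A -> y \in A -> phi x = phi y.
  move=> xA yA; have : inord (phi x) = inord (phi y) :> 'I_2 by rewrite !mono.
  move/(congr1 val); rewrite /= !inordK; by case: (phi x); case: (phi y).
have Aadj x y : x \in A -> y \in A -> x != y -> adj x y.
  move=> xA yA nxy; have := clA x; rewrite xA => /forallP/(_ y).
  by rewrite yA nxy.
have /card_gt1P[x [y [xA yA nxy]]] := A2.
have xy := Aadj x y xA yA nxy.
have [z xz yz] := phiE x y xy (phi_eq x y xA yA).
(* A third vertex of [A] would give a monochromatic triangle, so [A] is just the edge [xy]; the apex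
   [z] of a triangle on it then contradicts maximality. *)
have Axy w : w \in A -> w = x \/ w = y.
  move=> wA; have [|nxw] := eqVneq w x; first by left.
  have [|nyw] := eqVneq w y; first by right.
  case: (phiT x y w) => //; by [apply: Aadj; rewrite 1?eq_sym|apply: phi_eq].
have clz : clique (z |: A).
  apply/forallP=> s; apply/implyP; rewrite !inE => sA.
  apply/forallP=> t; apply/implyP; rewrite !inE => tA; apply/implyP=> nst.
  case/orP: sA tA nst => [/eqP->|sA] /orP[/eqP->|tA] nst.
  - by rewrite eqxx in nst.
  - by case: (Axy t tA) => ->; rewrite adj_sym.
  - by case: (Axy s sA) => ->.
  - exact: Aadj.
have zA : z \in A by rewrite -(maxA _ clz (subsetUr _ _)) setU11.
by case: (Axy z zA) => E; move: xz yz; rewrite E adj_irrefl.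
Qed.
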